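(* Let $\chi:\mathbb{R}\to\mathbb{R}$ be a kernel with compact support such that $\operatorname{supp}\chi\subset(0,+\infty)$. Then, for every function $f:\mathbb{R}\to\mathbb{R}$ for which the operators $S_wf$, $w>0$, are well-defined, and for every fixed $t\in\mathbb{R}$, we have $$(S_wf)(t)=\sum_{k\in\mathbb{Z},\ k/w<t}\chi(wt-k)\left[w\int_{k/w}^{(k+1)/w}f(u)\,du\right]$$ for every $w>0$ such that $wt\in\mathbb{Z}$. In particular, if $\operatorname{supp}\chi\subset[1,+\infty)$, then $$(S_wf)(t)=\sum_{k\in\mathbb{Z},\ k/w<t}\chi(wt-k)\left[w\int_{k/w}^{(k+1)/w}f(u)\,du\right]$$ for every $w>0$.
   Context: A function $\chi:\mathbb{R}\to\mathbb{R}$ is called a kernel if: (1) $\chi\in L^1(\mathbb{R})$ and $\chi$ is bounded on $[-1,1]$; (2) $\sum_{k\in\mathbb{Z}}\chi(u-k)=1$ for every $u\in\mathbb{R}$; (3) for some $\beta>0$, $m_\beta(\chi):=\sup_{u\in\mathbb{R}}\sum_{k\in\mathbb{Z}}|\chi(u-k)|\,|u-k|^\beta<+\infty$. For a kernel $\chi$ and $w>0$, the sampling Kantorovich operator is $(S_wf)(t):=\sum_{k\in\mathbb{Z}}\chi(wt-k)\left[w\int_{k/w}^{(k+1)/w}f(u)\,du\right]$, $t\in\mathbb{R}$; it is well-defined for $f:\mathbb{R}\to\mathbb{R}$ if $f$ is locally integrable and the series converges for each $t\in\mathbb{R}$. *)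

(* Defs.v *)
From HB Require Import structures.
From mathcomp Require Import all_boot all_order all_algebra.
From mathcomp Require Import all_classical all_reals all_analysis.
Import Order.TTheory GRing.Theory Num.Theory.
Import numFieldNormedType.Exports.

Set Implicit Arguments.
Unset Strict Implicit.
Unset Printing Implicit Defensive.

Local Open Scope classical_set_scope.
Local Open Scope ring_scope.

(* A series over Z converges when both halves, k >= 0 and k < 0, converge. *)
Definition zseries_cvg (R : realType) (a : int -> R) : Prop :=
  cvgn (series (fun n : nat => a n%:Z)) /\
  cvgn (series (fun n : nat => a (- n.+1%:Z))).

(* Meaningful only under [zseries_cvg a]. *)
Definition zsum (R : realType) (a : int -> R) : R :=
  limn (series (fun n : nat => a n%:Z)) +
  limn (series (fun n : nat => a (- n.+1%:Z))).

Definition is_zsum (R : realType) (a : int -> R) (s : R) : Prop :=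
  zseries_cvg a /\ s = zsum a.

Definition supp (R : realType) (chi : R -> R) : set R :=
  closure [set x | chi x != 0].

Definition abs_moment (R : realType) (beta : R) (chi : R -> R) : \bar R :=
  ereal_sup (range (fun u : R =>
    (\esum_(k in [set: int]) (`|chi (u - k%:~R)| * `|u - k%:~R| `^ beta)%:E)%E)).

(* The library's [locally_integrable] and [lebesgue_measure] live on the Borel
   sigma-algebra of R and would require Borel measurable functions; the
   completed measure gives Lebesgue measurability. *)
Definition loc_integrable (R : realType) (f : R -> R) : Prop :=
  forall K : set R, compact K ->
    completed_lebesgue_measure.-integrable K (EFin \o f).

Definition is_kernel (R : realType) (chi : R -> R) : Prop :=
  [/\ completed_lebesgue_measure.-integrable [set: R] (EFin \o chi),
      [bounded chi x | x in `[-1, 1]%classic],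
      forall u : R, is_zsum (fun k => chi (u - k%:~R)) 1
    & exists2 beta : R, 0 < beta & (abs_moment beta chi < +oo)%E].

Definition SK_term (R : realType) (chi f : R -> R) (w t : R) (k : int) : R :=
  chi (w * t - k%:~R) *
  (w * \int[completed_lebesgue_measure]_(u in `[k%:~R / w, (k + 1)%:~R / w]) f u).

Definition SK_well_defined (R : realType) (chi f : R -> R) (w : R) : Prop :=
  loc_integrable f /\
  forall t : R, zseries_cvg (SK_term chi f w t).

Definition SK (R : realType) (chi f : R -> R) (w t : R) : R :=
  zsum (SK_term chi f w t).

(* The terms of [SK] with k / w < t; the other terms are replaced by 0. *)
Definition SK_past_term (R : realType) (chi f : R -> R) (w t : R) (k : int) : R :=
  if k%:~R / w < t then SK_term chi f w t k else 0.

(* Main.v *)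
(* If k / w >= t then w t - k <= 0 lies outside the support of chi, so every
   term with k / w >= t vanishes and the two series agree term by term. *)
Require Import Defs.
From HB Require Import structures.
From mathcomp Require Import all_boot all_order all_algebra.
From mathcomp Require Import all_classical all_reals all_analysis.
Import Order.TTheory GRing.Theory Num.Theory.
Import numFieldNormedType.Exports.

Local Open Scope classical_set_scope.
Local Open Scope ring_scope.

(** The kernel is causal: a sample with [k / w >= t] is weighted by [chi] at a nonpositive point,
    hence by 0. By [SK_past_termE], truncation leaves the whole family of terms unchanged, so no
    limit argument is needed. *)

Lemma SK_past_termE (R : realType) (chi f : R -> R) (w t : R) :
  supp chi `<=` `]0, +oo[%classic -> 0 < w ->
  SK_past_term chi f w t = SK_term chi f w t.
Proof.
move=> chi_supp w_gt0; apply/funext => k; rewrite /SK_past_term.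
case: ifPn => //; rewrite -leNgt ler_pdivlMr // mulrC => le_wt_k.
rewrite /SK_term; have [->|chi_neq0] := eqVneq (chi (w * t - k%:~R)) 0.
  by rewrite mul0r.
(* A nonzero value puts [w * t - k] in the support, hence strictly above 0, against [w * t <= k];
   the open endpoint settles [k = w * t]. *)
have /chi_supp /= : supp chi (w * t - k%:~R) by exact: subset_closure.
by rewrite in_itv /= andbT subr_gt0 ltNge le_wt_k.
Qed.

Theorem theorem3p3 (R : realType) (chi : R -> R)
    (chi_kernel : is_kernel chi)
    (chi_compact : compact (supp chi))
    (chi_supp : supp chi `<=` `]0, +oo[%classic) :
  forall f : R -> R,
    (forall w : R, 0 < w -> SK_well_defined chi f w) ->
  forall t : R,
    (forall w : R, 0 < w -> w * t \is a Num.int ->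
       is_zsum (SK_past_term chi f w t) (SK chi f w t)) /\
    (supp chi `<=` `[1, +oo[%classic ->
     forall w : R, 0 < w ->
       is_zsum (SK_past_term chi f w t) (SK chi f w t)).
Proof.
move=> f f_wd t.
have past_sum w : 0 < w -> is_zsum (SK_past_term chi f w t) (SK chi f w t).
  (* With equal terms, the value is [SK] by definition and convergence comes from [f_wd]. *)
  move=> w_gt0; rewrite SK_past_termE //; split=> //.
  by have [_] := f_wd w w_gt0.
by split=> [w w_gt0 _|_ w w_gt0]; exact: past_sum.
Qed.
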